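(* Let $X$ and $Y$ be Banach spaces (both real or both complex), and let $U$ and $V$ be closed subspaces of $X$ and $Y$, respectively. Let $S\in\mathcal{F}(Y^*,X^* )$ satisfy $S(V^\perp)\subset U^\perp$. Let $F$ be a finite-dimensional subspace of $Y^*$ and let $\varepsilon>0$. Then there exists $T\in\mathcal{F}(X,Y)$ satisfying $T(U)\subset V$ such that (1) $\bigl| \| T\|-\| S\|\bigr|<\varepsilon$; (2) $T^*y^*=Sy^*$ for all $y^*\in F$; (2') $\operatorname{ran} T^*= \operatorname{ran} S$; (3) $T^{**}x^{**}=S^*x^{**}$ for all those $x^{**}\in X^{**}$ for which $S^*x^{**}\in Y$. In the special case when $X=Y$ and $S$ is a projection, $T$ can also be taken to be a projection.
   Context: For Banach spaces $X,Y$, $\mathcal{F}(X,Y)$ denotes the space of bounded linear finite-rank operators from $X$ to $Y$. For a subspace $U$ of $X$, $U^\perp=\{x^*\in X^*: x^*(x)=0\ \forall x\in U\}$ is its annihilator. Banach spaces are regarded as subspaces of their biduals via the canonical embedding; $\operatorname{ran}$ denotes the range of an operator. *)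

(* Defs.v *)
From HB Require Import structures.
From mathcomp Require Import all_boot all_order all_algebra.
From mathcomp Require Import all_classical all_reals all_analysis.
From mathcomp Require Import complex.
Set Implicit Arguments. Unset Strict Implicit. Unset Printing Implicit Defensive.
Import Order.TTheory GRing.Theory Num.Theory.
Import numFieldNormedType.Exports.
Local Open Scope classical_set_scope.
Local Open Scope ring_scope.

Definition Kb (R : realType) (b : bool) : numFieldType :=
  if b then (R : numFieldType) else (R[i] : numFieldType).

Definition bdd_by {K : numFieldType} {X Z : normedModType K} (f : X -> Z) (M : K) : Prop :=
  forall x, `|f x| <= M * `|x|.

Definition is_lin {K : numFieldType} {X Z : normedModType K} (f : X -> Z) : Prop :=
  forall (a : K) (x y : X), f (a *: x + y) = a *: f x + f y.

Definition bounded_linear {K : numFieldType} {X Z : normedModType K} (f : X -> Z) : Prop :=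
  is_lin f /\ exists M : K, bdd_by f M.

Definition fin_op {K : numFieldType} {X Z : normedModType K} (T : X -> Z) : Prop :=
  bounded_linear T /\
  exists (n : nat) (e : 'I_n -> Z), forall x, exists c : 'I_n -> K,
      T x = \sum_(i < n) c i *: e i.

Definition opnorm_is {K : numFieldType} {X Z : normedModType K} (T : X -> Z) (n : K) : Prop :=
  0 <= n /\ bdd_by T n /\ forall M, 0 <= M -> bdd_by T M -> n <= M.

Definition dual {K : numFieldType} (X : normedModType K) : set (X -> K^o) :=
  [set f | bounded_linear f].
Arguments dual {K} X _.

Definition perp {K : numFieldType} {X : normedModType K} (U : set X) : set (X -> K^o) :=
  [set f | dual X f /\ forall x, U x -> f x = 0].

Definition closed_subspace {K : numFieldType} {X : normedModType K} (U : set X) : Prop :=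
  U 0 /\ (forall (a : K) x y, U x -> U y -> U (a *: x + y)) /\ closed U.

Definition fd_dual_subspace {K : numFieldType} {Y : normedModType K}
  (F : set (Y -> K^o)) : Prop :=
  exists (n : nat) (e : 'I_n -> (Y -> K^o)), (forall i, dual Y (e i)) /\
    F = [set g | exists c : 'I_n -> K, g = fun y => \sum_(i < n) c i * e i y].

(* ||S g|| <= M ||g|| for all g in dual Y *)
Definition dual_bdd_by {K : numFieldType} {X Y : normedModType K}
  (S : (Y -> K^o) -> (X -> K^o)) (M : K) : Prop :=
  forall g, dual Y g -> forall N : K, 0 <= N -> bdd_by g N -> bdd_by (S g) (M * N).

Definition dual_fin_op {K : numFieldType} {X Y : normedModType K}
  (S : (Y -> K^o) -> (X -> K^o)) : Prop :=
  (forall g, dual Y g -> dual X (S g)) /\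
  (forall (a : K) g h, dual Y g -> dual Y h ->
     S (fun y => a * g y + h y) = (fun x => a * S g x + S h x)) /\
  (exists M : K, dual_bdd_by S M) /\
  (exists (n : nat) (e : 'I_n -> (X -> K^o)), forall g, dual Y g ->
     exists c : 'I_n -> K, S g = fun x => \sum_(i < n) c i * e i x).

Definition dual_opnorm_is {K : numFieldType} {X Y : normedModType K}
  (S : (Y -> K^o) -> (X -> K^o)) (n : K) : Prop :=
  0 <= n /\ dual_bdd_by S n /\ forall M, 0 <= M -> dual_bdd_by S M -> n <= M.

Definition adjoint {K : numFieldType} {X Y : normedModType K} (T : X -> Y) :
  (Y -> K^o) -> (X -> K^o) := fun g => g \o T.

Definition dadjoint {K : numFieldType} {X Y : normedModType K}
  (S : (Y -> K^o) -> (X -> K^o)) : ((X -> K^o) -> K^o) -> ((Y -> K^o) -> K^o) :=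
  fun x'' => x'' \o S.

(* The bidual X^{star star}: bounded linear functionals on dual X (values off dual X irrelevant) *)
Definition bidual {K : numFieldType} (X : normedModType K) : set ((X -> K^o) -> K^o) :=
  [set phi | (forall (a : K) f g, dual X f -> dual X g ->
                phi (fun x => a * f x + g x) = a * phi f + phi g) /\
             exists M : K, forall f, dual X f -> forall N : K, 0 <= N -> bdd_by f N ->
                `|phi f| <= M * N].
Arguments bidual {K} X _.

Definition bidual_eq {K : numFieldType} {Y : normedModType K}
  (p q : (Y -> K^o) -> K^o) : Prop := forall g, dual Y g -> p g = q g.

Definition in_canon {K : numFieldType} {Y : normedModType K}
  (p : (Y -> K^o) -> K^o) : Prop := exists y : Y, forall g, dual Y g -> p g = g y.

(* Main.v *)
Require Import Defs.
From HB Require Import structures.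
From mathcomp Require Import all_boot all_order all_algebra.
From mathcomp Require Import all_classical all_reals all_analysis.
From mathcomp Require Import complex.
From mathcomp Require Import ring lra.
Import Order.TTheory GRing.Theory Num.Theory.
Import numFieldNormedType.Exports.
Set Implicit Arguments. Unset Strict Implicit. Unset Printing Implicit Defensive.
Local Open Scope classical_set_scope.
Local Open Scope ring_scope.

(* Choose a basis [S (g i)] of [ran S] biorthogonal to points [p i] of [X]. Then
   [S h x = sum_i S h (p i) * S (g i) x], and the wanted operators are the maps
   [T x = sum_i S (g i) x *: y i] with [y i] in [Y] imitating the bidual elements
   [h |-> S h (p i)]. Conditions (2), (2'), (3) and [T(U) <= V] only restrict the
   [y i] to an affine subspace of [Y^n]: splitting [K^n] into the coefficient
   vectors whose image under [S^*] lies in [Y], a complement of these inside the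
   coefficients of [U], and a remainder, it is described by finitely many linear
   equations inside [{0}], [V] and [Y] respectively. On a finite net of the unit
   ball of [X], the Hahn-Banach theorem in [Y^N] with the sup norm (Helly's
   argument) produces a point of this affine subspace of norm at most
   [||S|| + eps]. Adding to [F] the [g i] and a functional almost norming [S]
   gives (2') and the lower norm bound; adding [ran S] makes [T] idempotent when
   [S] is. *)

(* The common interface through which [R] and [R[i]] are treated uniformly. *)
Record real_part (R : realType) (K : numFieldType) := RealPart {
  inj : {rmorphism R -> K};
  re : K -> R;
  reP : forall r z w, re (inj r * z + w) = r * re z + re w;
  re_inj : forall r, re (inj r) = r;
  inj_ge0 : forall r, 0 <= r -> 0 <= inj r;
  re_ge0 : forall z, 0 <= z -> 0 <= re z;
  inj_re : forall z, 0 <= z -> inj (re z) = z;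
  re_le_norm : forall z, re z <= re `|z|;
  re_lift : forall (E : lmodType K) (u : E -> R),
    (forall r x y, u (inj r *: x + y) = r * u x + u y) ->
    exists g : E -> K, (forall a x y, g (a *: x + y) = a * g x + g y) /\
      forall x, re (g x) = u x;
  scalar_net : forall B d : K, 0 < d ->
    exists s : seq K, forall z, `|z| <= B -> exists2 w, w \in s & `|z - w| <= d
}.

(** * Hahn-Banach extension over the common scalar interface *)

Section RealPartTheory.
Variables (R : realType) (K : numFieldType) (rp : real_part R K).
Notation inj := (inj rp).
Notation re := (re rp).

Lemma re0 : re 0 = 0.
Proof. by rewrite -(rmorph0 inj) re_inj. Qed.

Lemma reD z w : re (z + w) = re z + re w.
Proof. by rewrite -[z]mul1r -{1}(rmorph1 inj) reP mul1r mul1r. Qed.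

Lemma reM r z : re (inj r * z) = r * re z.
Proof. by rewrite -[_ * z]addr0 reP re0 addr0. Qed.

Lemma reN z : re (- z) = - re z.
Proof. by apply/eqP; rewrite -addr_eq0 -reD addNr re0. Qed.

Lemma reB z w : re (z - w) = re z - re w.
Proof. by rewrite reD reN. Qed.

Lemma re_sum (I : Type) (r : seq I) (P : pred I) (F : I -> K) :
  re (\sum_(i <- r | P i) F i) = \sum_(i <- r | P i) re (F i).
Proof. exact: (big_morph re reD re0). Qed.

Lemma le_re z w : z <= w -> re z <= re w.
Proof. by rewrite -subr_ge0 => /(re_ge0 rp); rewrite reB subr_ge0. Qed.

Lemma inj_le r s : r <= s -> inj r <= inj s.
Proof. by rewrite -subr_ge0 => /(inj_ge0 rp); rewrite rmorphB subr_ge0. Qed.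

Lemma re_le z w : 0 <= z -> 0 <= w -> re z <= re w -> z <= w.
Proof. by move=> z0 w0 /inj_le; rewrite !inj_re. Qed.

Lemma reMge0 z w : 0 <= z -> re (z * w) = re z * re w.
Proof. by move=> z0; rewrite -{1}(inj_re rp z0) reM. Qed.

Lemma normr_inj r : 0 <= r -> `|inj r| = inj r.
Proof. by move=> r0; rewrite ger0_norm// inj_ge0. Qed.

(* A real Hahn-Banach theorem on graphs: a graph dominated by a sublinear
   map is automatically single valued. *)
Lemma hahn_banach_graph (E : lmodType K) (p : E -> R) (G : set (E * R)) :
  (forall x y, p (x + y) <= p x + p y) ->
  (forall r x, 0 <= r -> p (inj r *: x) = r * p x) ->
  G (0, 0) ->
  (forall r x y, G x -> G y -> G (inj r *: x.1 + y.1, r * x.2 + y.2)) ->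
  (forall x r, G (x, r) -> r <= p x) ->
  exists u : E -> R, [/\ forall r x y, u (inj r *: x + y) = r * u x + u y,
    forall x, u x <= p x & forall x r, G (x, r) -> u x = r].
Proof.
move=> pD pZ G00 Glin Gp.
pose good (H : set (E * R)) :=
  (forall r x y, H x -> H y -> H (inj r *: x.1 + y.1, r * x.2 + y.2)) /\
  (forall x r, H (x, r) -> r <= p x).
have goodG : good G by split.
(* Zorn's lemma runs over the sets added to [G] rather than over the graphs containing [G], so that
   the empty chain, with empty union, is covered as well. *)
have [F FG Ftot|A [[Hlin Hp] Amax]] := @Zorn_bigcup _ [set A | good (G `|` A)].
  split=> [r x y|x r].
  - move=> [Gx|[A FA Ax]] [Gy|[B FB By]].
    + by left; exact: Glin.
    + have [h _] := FG _ FB.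
      by have [?|?] := h r x y (or_introl Gx) (or_intror By);
        [left|right; exists B].
    + have [h _] := FG _ FA.
      by have [?|?] := h r x y (or_intror Ax) (or_introl Gy);
        [left|right; exists A].
    + have [C [FC Cx Cy]] : exists C, [/\ F C, C x & C y].
        have [AB|BA] := Ftot _ _ FA FB; first by exists B; split=> //; exact: AB.
        by exists A; split=> //; exact: BA.
      have [h _] := FG _ FC.
      by have [?|?] := h r x y (or_intror Cx) (or_intror Cy);
        [left|right; exists C].
  - move=> [Gx|[A FA Ax]]; first exact: Gp.
    by have [_] := FG _ FA; apply; right.
set H := G `|` A in Hlin Hp.
have H00 : H (0, 0) by left.
have HZ r x : H x -> H (inj r *: x.1, r * x.2).
  by move=> /Hlin /(_ H00) => /(_ r) /=; rewrite !addr0.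
have HD x y : H x -> H y -> H (x.1 + y.1, x.2 + y.2).
  by move=> Hx Hy; have := Hlin 1 _ _ Hx Hy; rewrite rmorph1 scale1r mul1r.
have p0 : p 0 = 0 by rewrite -(scaler0 _ (inj 0)) pZ// mul0r.
have Huniq x r s : H (x, r) -> H (x, s) -> r = s.
  move=> Hr Hs; apply/eqP; rewrite eq_le; apply/andP; split.
    have := Hlin (-1) _ _ Hs Hr.
    by rewrite /= rmorphN1 scaleN1r addNr mulN1r => /Hp; rewrite p0 addrC subr_le0.
  have := Hlin (-1) _ _ Hr Hs.
  by rewrite /= rmorphN1 scaleN1r addNr mulN1r => /Hp; rewrite p0 addrC subr_le0.
have Htot x : exists r, H (x, r).
  apply: contrapT => nHx.
  (* One-dimensional extension: a value at [x] must lie above every [r - p (y - x)] and below every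
     [p (z + x) - t]. Subadditivity separates the two families, and [c] is the supremum of the
     first. *)
  pose L := [set s | exists y r, H (y, r) /\ s = r - p (y - x)].
  have ubL z t : H (z, t) -> ubound L (p (z + x) - t).
    move=> Hz _ [y [r [Hy ->]]].
    have := Hp _ _ (HD _ _ Hy Hz) => /=.
    have : p (y + z) <= p (y - x) + p (z + x).
      by rewrite (_ : y + z = (y - x) + (z + x)) ?pD// addrACA addNr addr0.
    lra.
  have supL : has_sup L.
    split; first by exists (0 - p (0 - x)), 0, 0.
    by exists (p (0 + x) - 0); exact: ubL.
  pose c := sup L.
  have cl y r : H (y, r) -> r - p (y - x) <= c.
    by move=> Hy; apply: ub_le_sup; [exact: supL.2|exists y, r].
  have cu y r : H (y, r) -> c <= p (y + x) - r.
    by move=> Hy; apply: ge_sup; [exact: supL.1|exact: ubL].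
  pose H' := [set v : E * R | exists a y, H y /\
    v = (y.1 + inj a *: x, y.2 + a * c)].
  have HH' : H `<=` H'.
    by move=> [y r] Hy; exists 0, (y, r); rewrite rmorph0 scale0r mul0r !addr0.
  apply: (Amax H').
    split; first by move=> v Av; apply: HH'; right.
    move=> H'A; apply: nHx; exists c; right; apply: H'A.
    by exists 1, (0, 0); rewrite rmorph1 scale1r mul1r !add0r.
  have GH' : G `|` H' = H' by apply/setUidPr => v Gv; apply: HH'; left.
  rewrite /= GH'.
  split=> [r _ _ [a [y [Hy ->]]] [b [z [Hz ->]]]/=|].
    exists (r * a + b), (inj r *: y.1 + z.1, r * y.2 + z.2) => /=.
    split; first exact: Hlin.
    congr pair; last ring.
    rewrite rmorphD rmorphM scalerDr scalerDl scalerA.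
    by rewrite addrACA.
  move=> v s [a [[y r] [Hy [-> ->]]]] /=.
  (* Dividing by the absolute value of [a] reduces domination to the upper bounds on [c] if [a > 0]
     and to the lower bounds if [a < 0]. *)
  have [a0|a0|->] := ltgtP a 0; last first.
  - by rewrite rmorph0 scale0r mul0r !addr0; exact: Hp.
  - have := cu _ _ (HZ a^-1 _ Hy) => /=.
    rewrite -(ler_pM2l a0) mulrBr -(pZ _ _ (ltW a0)) scalerDr scalerA -rmorphM.
    rewrite mulrA divff ?gt_eqF// rmorph1 scale1r mul1r; lra.
  - have b0 : 0 < - a by rewrite oppr_gt0.
    have := cl _ _ (HZ (- a)^-1 _ Hy) => /=.
    rewrite -(ler_pM2l b0) mulrBr -(pZ _ _ (ltW b0)) scalerBr scalerA -rmorphM.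
    rewrite mulrA divff ?gt_eqF// rmorph1 scale1r mul1r rmorphN scaleNr opprK.
    lra.
have [u Hu] := choice Htot.
exists u; split=> [r x y|x|x r Gx].
- by apply: Huniq (Hu _) _; exact: (Hlin r _ _ (Hu x) (Hu y)).
- exact: Hp.
- by apply: Huniq (Hu x) _; left.
Qed.

(** The real parts of the prescribed values are extended and the result is lifted to a scalar
    functional. Multiplying by a scalar of modulus one makes a given value nonnegative, so a bound
    on real parts is one on moduli, and [g x - z] vanishes because its rotated value has real part
    zero. *)
Lemma hahn_banach (E : lmodType K) (p : E -> R) (G : set (E * K)) :
  (forall x y, p (x + y) <= p x + p y) ->
  (forall a x, p (a *: x) = re `|a| * p x) ->
  G (0, 0) ->
  (forall a x y, G x -> G y -> G (a *: x.1 + y.1, a * x.2 + y.2)) ->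
  (forall x z, G (x, z) -> re `|z| <= p x) ->
  exists g : E -> K, [/\ forall a x y, g (a *: x + y) = a * g x + g y,
    forall x, re `|g x| <= p x & forall x z, G (x, z) -> g x = z].
Proof.
move=> pD pZ G00 Glin Gp.
pose Gr := [set v : E * R | exists z, G (v.1, z) /\ v.2 = re z].
have [r x r0|||x r [z [/= Gz ->]]|u [ulin up uG]] :=
    @hahn_banach_graph E p Gr pD.
- by rewrite pZ normr_inj// re_inj.
- by exists 0; rewrite re0.
- move=> r [x _] [y _] [z [/= Gz ->]] [w [/= Gw ->]]; exists (inj r * z + w).
  by rewrite /= reP; split=> //; exact: (Glin _ _ _ Gz Gw).
- by apply: le_trans (Gp _ _ Gz); exact: re_le_norm.
have [g [glin gre]] := re_lift ulin.
have g0 : g 0 = 0.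
  have := glin (-1) 0 0; rewrite scaler0 addr0 mulN1r => {1}->.
  by rewrite addNr.
have gZ a x : g (a *: x) = a * g x by rewrite -[a *: x]addr0 glin g0 addr0.
have polar z : exists2 l : K, `|l| = 1 & l * z = `|z|.
  have [->|z0] := eqVneq z 0; first by exists 1; rewrite ?normr1// mulr0 normr0.
  exists (`|z| / z); last by rewrite divfK.
  by rewrite normrM normfV normr_id divff// normr_eq0.
exists g; split=> // [x|x z Gz].
  have [l l1 lg] := polar (g x).
  rewrite -lg -gZ gre (le_trans (up _))// pZ l1.
  by rewrite -(rmorph1 inj) re_inj mul1r.
have [l l1 lg] := polar (g x - z).
have Glz : G (l *: x, l * z) by have := Glin l _ _ Gz G00; rewrite /= !addr0.
have : re `|g x - z| = 0.
  rewrite -lg mulrBr reB -gZ gre.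
  by rewrite (uG _ (re (l * z))) ?subrr//; exists (l * z).
move=> /(congr1 inj); rewrite inj_re// rmorph0 => /eqP.
by rewrite normr_eq0 subr_eq0 => /eqP.
Qed.

End RealPartTheory.

(** * The real and the complex scalars as instances of the interface *)

Section Instances.
Variable R : realType.

Lemma real_net (B d : R) : 0 < d ->
  exists s : seq R, forall z, `|z| <= B -> exists2 w, w \in s & `|z - w| <= d.
Proof.
move=> d0; pose m := Num.truncn ((B + B) / d).
exists [seq k%:R * d - B | k <- iota 0 m.+1] => z; rewrite ler_norml => /andP[z1 z2].
pose k := Num.truncn ((z + B) / d).
have zB : 0 <= (z + B) / d by rewrite divr_ge0 ?(ltW d0)//; lra.
exists (k%:R * d - B).
  apply/mapP; exists k => //; rewrite mem_iota add0n ltnS.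
  by apply: le_truncn; rewrite ler_pM2r ?invr_gt0//; lra.
have /andP[] := truncn_itv zB.
rewrite -/k ler_pdivlMr// ltr_pdivrMr// -natr1 mulrDl mul1r => h1 h2.
rewrite ler_norml; apply/andP; split; lra.
Qed.

Lemma real_lift (E : lmodType R) (u : E -> R) :
  (forall r x y, u (r *: x + y) = r * u x + u y) ->
  exists g : E -> R, (forall a x y, g (a *: x + y) = a * g x + g y) /\
    forall x, g x = u x.
Proof. by move=> ?; exists u. Qed.

Definition real_part_real : real_part R (R : numFieldType).
Proof.
refine (@RealPart R R (idfun : {rmorphism R -> R}) idfun _ _ _ _ _ _ _ _) => //=.
- exact: ler_norm.
- exact: real_lift.
- exact: real_net.
Defined.

Local Open Scope complex_scope.

(** The classical formula [u x - 'i * u ('i *: x)] recovers a complex-linear functional from its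
    real part. *)
Lemma complex_lift (E : lmodType R[i]) (u : E -> R) :
  (forall r x y, u (r%:C *: x + y) = r * u x + u y) ->
  exists g : E -> R[i], (forall a x y, g (a *: x + y) = a * g x + g y) /\
    forall x, complex.Re (g x) = u x.
Proof.
move=> ulin; exists (fun x => u x +i* (- u ('i *: x))); split=> // a x y.
have uD v w : u (v + w) = u v + u w.
  by have := ulin 1 v w; rewrite scale1r mul1r.
have u0 : u 0 = 0 by apply: (addIr (u 0)); rewrite -uD add0r add0r.
have uZ r v : u (r%:C *: v) = r * u v.
  by have := ulin r v 0; rewrite u0 !addr0.
case: a => a b.
have -> : a +i* b = a%:C + b%:C * 'i by rewrite mulrC [LHS]complexE.
have iv (z : E) : 'i *: ('i *: z) = (-1)%:C *: z.
  by rewrite scalerA -expr2 sqr_i rmorphN1.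
have E1 : u ((a%:C + b%:C * 'i) *: x + y) = a * u x + b * u ('i *: x) + u y.
  by rewrite uD scalerDl uD uZ -scalerA uZ.
have E2 : u ('i *: ((a%:C + b%:C * 'i) *: x + y)) =
    a * u ('i *: x) - b * u x + u ('i *: y).
  have ic (r : R) (z : E) : 'i *: (r%:C *: z) = r%:C *: ('i *: z).
    by rewrite !scalerA mulrC.
  by rewrite scalerDr uD scalerDl scalerDr uD -scalerA !ic iv !uZ; ring.
rewrite E1 E2; apply/eqP; rewrite eq_complex/=; apply/andP; split; apply/eqP; ring.
Qed.

Lemma complex_net (B d : R[i]) : 0 < d ->
  exists s : seq R[i], forall z, `|z| <= B -> exists2 w, w \in s & `|z - w| <= d.
Proof.
move=> d0; have dE : d = (complex.Re d)%:C by rewrite RRe_real ?gtr0_real.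
have d20 : 0 < complex.Re d / 2 by move: d0; rewrite dE ltcR/=; lra.
have [s sP] := real_net (complex.Re B) d20.
exists [seq a +i* b | a <- s, b <- s] => -[a b] zB.
have BE : B = (complex.Re B)%:C.
  by rewrite RRe_real// ger0_real// (le_trans _ zB).
have za : `|a| <= complex.Re B.
  by rewrite -lecR -BE (le_trans (normc_ge_Re (a +i* b))).
have zb : `|b| <= complex.Re B.
  (* Multiplication by ['i] moves the imaginary part into the real part, up to sign. *)
  rewrite -lecR -BE (le_trans _ zB)// -(mul1r `|a +i* b|).
  have <- : `|'i| = 1 :> R[i] by rewrite normc_def/= expr0n/= add0r expr1n sqrtr1.
  rewrite -normrM (le_trans _ (normc_ge_Re _))//=.
  by rewrite mul0r mul1r add0r normrN.
have [a' a's aa] := sP _ za; have [b' b's bb] := sP _ zb.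
exists (a' +i* b'); first by apply/allpairsP; exists (a', b').
have -> : a +i* b - (a' +i* b') = (a - a')%:C + 'i * (b - b')%:C.
  by rewrite [LHS]complexE.
rewrite (le_trans (ler_normD _ _))// normrM.
have -> : `|'i| = 1 :> R[i] by rewrite normc_def/= expr0n/= add0r expr1n sqrtr1.
rewrite mul1r !normc_def/= expr0n/= !addr0 !sqrtr_sqr -rmorphD dE lecR; lra.
Qed.

Definition real_part_complex : real_part R (R[i] : numFieldType).
Proof.
refine (@RealPart R R[i] (real_complex R : {rmorphism R -> R[i]})
  (@complex.Re R) _ _ _ _ _ _ _ _) => //=.
- by move=> r [a b] [c e] /=; rewrite mul0r subr0.
- by move=> r; rewrite ler0c.
- by move=> z; rewrite lecE => /andP[].
- by move=> z z0; rewrite RRe_real// ger0_real.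
- move=> z; rewrite -lecR (@RRe_real _ `|z|) ?normr_real//.
  by rewrite (le_trans _ (normc_ge_Re z))// lecR ler_norm.
- exact: complex_lift.
- exact: complex_net.
Defined.

End Instances.

(** * Separation, norms of functionals and Helly's theorem *)

Section FunctionalAnalysis.
Variables (R : realType) (K : numFieldType) (rp : real_part R K).
Notation inj := (inj rp).
Notation re := (re rp).

(** The functional [z *: y + v |-> z] on the span of [y] and [V] is dominated by the norm divided by
    [r], because [r] is a lower bound for the distance from [y] to [V]. *)
Lemma separation (Y : normedModType K) (V : set Y) (y : Y) (r : K) :
  V 0 -> (forall a u v, V u -> V v -> V (a *: u + v)) -> 0 < r ->
  (forall v, V v -> r <= `|y - v|) ->
  exists g, perp V g /\ g y = 1.
Proof.
move=> V0 Vlin r0 rV.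
pose p (x : Y) := re (r^-1 * `|x|).
pose G := [set z : Y * K | exists v, V v /\ z.1 = z.2 *: y + v].
have ri0 : 0 <= r^-1 by rewrite invr_ge0 ltW.
have [|||||g [glin gp gG]] := @hahn_banach _ _ rp Y p G.
- by move=> x z; rewrite /p -reD le_re// -mulrDr ler_wpM2l// ler_normD.
- by move=> a x; rewrite /p normrZ mulrCA (reMge0 _ _ (normr_ge0 a)).
- by exists 0; rewrite scale0r addr0.
- move=> a [x b] [z c] [v [Vv /= ->]] [w [Vw /= ->]].
  exists (a *: v + w); split; first exact: Vlin.
  by rewrite /= scalerDr scalerDl scalerA addrACA.
- move=> x z [v [Vv /= ->]]; apply: le_re; rewrite mulrC ler_pdivlMr//.
  have [->|z0] := eqVneq z 0; first by rewrite normr0 mul0r.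
  have -> : z *: y + v = z *: (y - ((- z^-1) *: v + 0)).
    by rewrite addr0 scaleNr opprK scalerDr scalerA divff// scale1r.
  by rewrite normrZ ler_wpM2l//; apply: rV; exact: Vlin.
exists g; split; last by apply: gG; exists 0; rewrite /= scale1r addr0.
split; last by move=> v Vv; apply: gG; exists v; rewrite /= scale0r add0r.
split; first exact: glin.
exists r^-1 => x; apply: (@re_le _ _ rp) => //; exact: mulr_ge0.
Qed.

Lemma perp_separates (Y : normedModType K) (V : set Y) (y : Y) :
  closed_subspace V -> ~ V y -> exists g, perp V g /\ g y = 1.
Proof.
move=> [V0 [Vlin Vcl]] nVy.
have : nbhs y (~` V) by apply: open_nbhs_nbhs; split=> //; exact: closed_openC.
move=> /nbhs_ballP[r /= r0 rV]; apply: (separation V0 Vlin r0) => v Vv.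
rewrite real_leNgt ?normr_real ?gtr0_real//; apply/negP => yv.
by apply: (rV v) => //; rewrite -ball_normE.
Qed.

(** The norm is taken as a supremum in [R], where completeness is available. Rotating a nearly
    maximal vector makes its value nonnegative, so that real parts suffice in the last clause. *)
Lemma functional_norm (Y : normedModType K) (f : Y -> K^o) : dual Y f ->
  exists n : R, [/\ 0 <= n, bdd_by f (inj n) &
    forall e, 0 < e -> exists y, `|y| <= 1 /\ n - e <= re (f y)].
Proof.
move=> [flin [M fM]].
have f0 : f 0 = 0.
  by have := fM 0; rewrite normr0 mulr0 normr_le0 => /eqP.
have fZ a x : f (a *: x) = a * f x.
  by have := flin a x 0; rewrite f0 !addr0.
pose A := [set s | exists y : Y, `|y| <= 1 /\ s = re `|f y|].
have A0 : A 0 by exists 0; rewrite f0 !normr0 re0.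
have M0 (x : Y) : x != 0 -> 0 <= M.
  move=> x0; have := le_trans (normr_ge0 _) (fM x).
  by rewrite pmulr_lge0// normr_gt0.
have ubA : ubound A (re (`|M|)).
  move=> _ [y [y1 ->]]; apply: le_re.
  have [->|y0] := eqVneq y 0; first by rewrite f0 normr0.
  rewrite (le_trans (fM y))// ger0_norm ?(M0 y)//.
  by rewrite ler_piMr// (M0 y).
have supA : has_sup A by split; [exists 0|exists (re `|M|)].
have leA s : A s -> s <= sup A by move=> As; apply: ub_le_sup => //; exact: supA.2.
exists (sup A); split.
- exact: leA.
- move=> y; have [->|y0] := eqVneq y 0; first by rewrite f0 !normr0 mulr0.
  have y0' : 0 < `|y| by rewrite normr_gt0.
  rewrite -ler_pdivrMr//.
  apply: (@re_le _ _ rp); rewrite ?divr_ge0 ?inj_ge0 ?leA// re_inj.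
  apply: leA; exists (`|y|^-1 *: y); split.
    by rewrite normrZ normfV normr_id mulVf ?gt_eqF.
  by rewrite fZ normrM normfV normr_id mulrC.
- move=> e e0; have [_ [y [y1 ->]] ey] := sup_adherent e0 supA.
  have [fy0|fy0] := eqVneq (f y) 0.
    by exists 0; rewrite normr0 ler01 f0 re0; split=> //;
      move: ey; rewrite fy0 normr0 re0 => /ltW.
  exists ((`|f y| / f y) *: y); rewrite fZ divfK//; split; last exact: ltW.
  by rewrite normrZ normrM normfV normr_id divff ?mul1r// normr_eq0.
Qed.

(* Helly's theorem in [Y^J] with the sup norm: the quantity [sum_k s k (f k)]
   is the pairing of [s] in the bidual of [Y^J] with [f]. *)
Lemma helly (Y : normedModType K) (J : finType) (t : {ffun J -> Y})
    (A : set {ffun J -> Y}) (s : J -> (Y -> K^o) -> K) (M c : K) :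
  A 0 -> (forall a u v, A u -> A v -> A (a *: u + v)) ->
  0 <= M -> M < c ->
  (forall k f, dual Y f -> forall N, 0 <= N -> bdd_by f N -> `|s k f| <= M * N) ->
  (forall f : J -> Y -> K^o, (forall k, dual Y (f k)) ->
    (forall v, A v -> \sum_k f k (v k) = 0) ->
    \sum_k s k (f k) = \sum_k f k (t k)) ->
  exists2 v, A v & forall k, `|t k + v k| <= c.
Proof.
move=> A0 Alin M0 Mc sM sA; apply: contrapT => noA.
have c0 : 0 < c by exact: le_lt_trans Mc.
pose p (y : {ffun J -> Y}) : R := \big[Num.max/0]_k re `|y k|.
have re_norm_ge0 (x : Y) : 0 <= re `|x| by exact: re_ge0.
have p_ge (y : {ffun J -> Y}) k : re `|y k| <= p y by exact: le_bigmax.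
have p_le (y : {ffun J -> Y}) (r : R) :
    0 <= r -> (forall k, re `|y k| <= r) -> p y <= r.
  by move=> r0 yr; apply: bigmax_le.
have p_ge0 (y : {ffun J -> Y}) : 0 <= p y by exact: bigmax_ge_id.
have pD x y : p (x + y) <= p x + p y.
  apply: p_le => [|k]; first exact: addr_ge0.
  rewrite ffunE (le_trans (le_re rp (ler_normD _ _)))// reD.
  by rewrite lerD.
have pZle a x : p (a *: x) <= re `|a| * p x.
  apply: p_le => [|k]; first by rewrite mulr_ge0// re_ge0.
  by rewrite ffunE normrZ reMge0// ler_wpM2l// re_ge0.
have pZ a x : p (a *: x) = re `|a| * p x.
  apply/eqP; rewrite eq_le pZle/=.
  have [->|a0] := eqVneq a 0; first by rewrite normr0 re0 mul0r.
  have := pZle a^-1 (a *: x); rewrite scalerA mulVf// scale1r => h.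
  have := ler_wpM2l (re_ge0 rp (normr_ge0 a)) h.
  rewrite mulrA -reMge0// -normrM divff// normr1.
  by rewrite -(rmorph1 inj) re_inj mul1r.
(* On the span of [t] and [A], sending [a *: t + v] to [a * c] is dominated by the sup norm because
   no [t + v] lies in the ball of radius [c]. *)
pose G := [set z : {ffun J -> Y} * K |
  exists a v, A v /\ z = (a *: t + v, a * c)].
have [|||g [glin gp gG]] := @hahn_banach _ _ rp _ p G pD pZ.
- by exists 0, 0; rewrite scale0r mul0r addr0.
- move=> a _ _ [b [v [Av ->]]] [e [w [Aw ->]]] /=.
  exists (a * b + e), (a *: v + w); split; first exact: Alin.
  by congr pair; rewrite ?scalerDr ?scalerDl ?scalerA ?mulrDl ?mulrA// addrACA.
- move=> x z [a [v [Av [-> ->]]]].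
  have [->|a0] := eqVneq a 0; first by rewrite mul0r normr0 re0.
  have -> : a *: t + v = a *: (t + (a^-1 *: v + 0)).
    by rewrite addr0 scalerDr scalerA divff// scale1r.
  rewrite pZ normrM reMge0// ler_wpM2l ?re_ge0// gtr0_norm//.
  have [k nk] : exists k, ~ `|t k + (a^-1 *: v + 0 : {ffun J -> Y}) k| <= c.
    by apply/existsNP => h; apply: noA; exists (a^-1 *: v + 0) => //; exact: Alin.
  apply: le_trans (p_ge _ k); apply: le_re; rewrite [X in `|X|]ffunE.
  move/negP: nk; rewrite -real_ltNge ?normr_real ?gtr0_real//; exact: ltW.
have g0 : g 0 = 0.
  have := glin (-1) 0 0; rewrite scaler0 addr0 mulN1r => {1}->.
  by rewrite addNr.
have gD x y : g (x + y) = g x + g y by have := glin 1 x y; rewrite scale1r mul1r.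
(* Coordinate embeddings split [g] into functionals [f k] on [Y]. The [s k (f k)] sum to [c], while
   the norms of the [f k] sum to at most one by domination, which forces [c <= M]. *)
pose d k (y : Y) : {ffun J -> Y} := [ffun j => if j == k then y else 0].
pose f k : Y -> K^o := fun y => g (d k y).
have gE y : g y = \sum_k f k (y k).
  rewrite -(big_morph g gD g0); congr (g _); apply/ffunP => j.
  rewrite sum_ffunE (bigD1 j)//= ffunE eqxx big1 ?addr0// => k kj.
  by rewrite ffunE eq_sym (negbTE kj).
have fdual k : dual Y (f k).
  split=> [a x y|].
    rewrite /f -[_ *: g _]/(a * g _) -glin; congr (g _); apply/ffunP => j.
    by rewrite !ffunE; case: eqP; rewrite ?scaler0 ?addr0.
  exists 1 => x; rewrite mul1r; apply: (@re_le _ _ rp) => //.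
  rewrite (le_trans (gp _))//; apply: p_le => // j.
  by rewrite ffunE; case: eqP; rewrite ?normr0 ?re0.
have cE : \sum_k s k (f k) = c.
  rewrite sA//.
    by rewrite -gE; apply: gG; exists 1, 0; rewrite scale1r addr0 mul1r.
  by move=> v Av; rewrite -gE; apply: gG; exists 0, v; rewrite scale0r mul0r add0r.
have [n nP] := choice (fun k => functional_norm (fdual k)).
have n1 : \sum_k n k <= 1.
  apply/ler_addgt0Pr => e e0.
  (* The error is spread over the coordinates; the successor keeps the quotient meaningful for empty
     [J]. *)
  pose e' := e / (#|J|.+1)%:R.
  have e'0 : 0 < e' by rewrite divr_gt0.
  have /choice[y yP] k : exists y : Y, `|y| <= 1 /\ n k - e' <= re (f k y).
    by have [_ _] := nP k; apply.
  have h1 : \sum_k (n k - e') <= 1.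
    apply: (@le_trans _ _ (re (g [ffun k => y k]))).
      rewrite gE re_sum; apply: ler_sum => k _; rewrite ffunE.
      by have [] := yP k.
    rewrite (le_trans (re_le_norm rp _))// (le_trans (gp _))//.
    apply: p_le => // k; rewrite ffunE -(re_inj rp 1) rmorph1.
    by apply: le_re; have [] := yP k.
  move: h1; rewrite sumrB sumr_const lerBlDr => /le_trans; apply.
  rewrite lerD2l -mulr_natl mulrCA ger_pMr//.
  by rewrite ler_pdivrMr// mul1r ler_nat cardT -cardE.
have : c <= M.
  rewrite -cE.
  have -> : \sum_k s k (f k) = `|\sum_k s k (f k)| by rewrite cE gtr0_norm.
  rewrite (le_trans (ler_norm_sum _ _ _))//.
  apply: (@le_trans _ _ (\sum_k M * inj (n k))).
    apply: ler_sum => k _; have [n0 nb _] := nP k.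
    by apply: sM => //; rewrite inj_ge0.
  rewrite -mulr_sumr -rmorph_sum ler_piMr// -(rmorph1 inj); exact: inj_le.
by move=> /(lt_le_trans Mc); rewrite ltxx.
Qed.

End FunctionalAnalysis.

(** * Finite-dimensional linear algebra: subspaces as row spaces, interpolation, biorthogonal
    bases *)

Section LinearAlgebra.
Variable F : fieldType.

Definition islin (E : lmodType F) (f : E -> F) :=
  forall a x y, f (a *: x + y) = a * f x + f y.

Definition subsp (E : lmodType F) (V : set E) :=
  V 0 /\ forall a x y, V x -> V y -> V (a *: x + y).

Lemma islin_sum (E : lmodType F) (f : E -> F) (I : finType) (c : I -> F)
    (x : I -> E) :
  islin f -> f (\sum_i c i *: x i) = \sum_i c i * f (x i).
Proof.
move=> flin.
have f0 : f 0 = 0.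
  have := flin (-1) 0 0; rewrite scaler0 addr0 mulN1r => {1}->.
  by rewrite addNr.
have fD u v : f (u + v) = f u + f v by rewrite -[u]scale1r flin scale1r mul1r.
rewrite (big_morph f fD f0); apply: eq_bigr => i _.
by rewrite -[_ *: _]addr0 flin f0 addr0.
Qed.

Lemma subsp_sum (E : lmodType F) (V : set E) (I : finType) (c : I -> F)
    (x : I -> E) :
  subsp V -> (forall i, V (x i)) -> V (\sum_i c i *: x i).
Proof.
move=> [V0 Vlin] Vx; elim/big_rec: _ => // i y _ Vy; exact: Vlin.
Qed.

(** A matrix of maximal rank among those with row space inside [P] works: a vector of [P] outside
    its row space would raise the rank. *)
Lemma subsp_mx n (P : set 'rV[F]_n) : subsp P ->
  exists A : 'M[F]_n, forall v, P v <-> (v <= A)%MS.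
Proof.
move=> [P0 Plin].
pose Q k := `[< exists2 A : 'M[F]_n,
  (forall v : 'rV_n, (v <= A)%MS -> P v) & \rank A = k >].
have exQ : exists k, Q k.
  exists 0%N; apply/asboolP; exists 0; last by rewrite mxrank0.
  by move=> v; rewrite submx0 => /eqP->.
have Qn k : Q k -> (k <= n)%N by move=> /asboolP[A _ <-]; exact: rank_leq_row.
case: (ex_maxnP exQ Qn) => r /asboolP[A AP rA] rmax.
exists A => v; split; last exact: AP.
move=> Pv; apply/negPn/negP => nvA.
have /rmax : Q (\rank (A + v)%MS).
  apply/asboolP; exists (A + v)%MS => // w /sub_addsmxP[[u1 u2] ->] /=.
  rewrite addrC [u2]mx11_scalar mul_scalar_mx; apply: Plin => //.
  by apply: AP; exact: submxMl.
rewrite -rA leqNgt => /negP; apply.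
have : (A < A + v)%MS.
  by rewrite ltmxE addsmxSl/= addsmx_sub submx_refl.
by rewrite ltmxErank => /andP[].
Qed.

(** The space is split into [Z], a complement of [Z] in [Z + W] chosen inside [W], and a complement
    of [Z + W]. The repeated factors [p1] and [p2] let [a *m p1] and [a *m p2] serve later as
    coefficient vectors of the projected unit vectors. *)
Lemma adapted_projections n (Z W : 'M[F]_n) :
  exists p0 p1 p2 : 'M[F]_n,
  [/\ forall a : 'rV_n, a = a *m p0 + a *m p1 *m p1 + a *m p2 *m p2,
      forall a : 'rV_n, (a *m p0 <= Z)%MS,
      forall a : 'rV_n, (a *m p1 <= W)%MS,
      forall a : 'rV_n, (a <= Z)%MS -> a *m p1 = 0 /\ a *m p2 = 0 &
      forall a : 'rV_n, (a <= W)%MS -> a *m p2 = 0].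
Proof.
pose D := (W :\: Z)%MS; pose H := (Z + D)%MS; pose C := (H^C)%MS.
have ZD : (Z :&: D = 0)%MS by rewrite capmxC capmx_diff.
have DZ : (D :&: Z = 0)%MS by rewrite capmx_diff.
have HC : (H :&: C = 0)%MS by rewrite capmx_compl.
have CH : (C :&: H = 0)%MS by rewrite capmxC capmx_compl.
have WH : (W <= H)%MS.
  rewrite -(addsmx_diff_cap_eq W Z) addsmx_sub addsmxSr/=.
  by rewrite (submx_trans (capmxSr _ _)) ?addsmxSl.
pose q := proj_mx H C; pose p2 := proj_mx C H.
pose q0 := proj_mx Z D; pose q1 := proj_mx D Z.
have qid (a : 'rV_n) : (a <= H)%MS -> a *m q = a by exact: proj_mx_id.
have p2_0 (a : 'rV_n) : (a <= H)%MS -> a *m p2 = 0 by exact: proj_mx_0.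
have p1id (a : 'rV_n) : (a <= D)%MS -> a *m (q *m q1) = a.
  move=> aD; rewrite mulmxA qid ?proj_mx_id//.
  by rewrite (submx_trans aD) ?addsmxSr.
exists (q *m q0), (q *m q1), p2; split=> a.
- rewrite (p1id (a *m (q *m q1))); last by rewrite mulmxA proj_mx_sub.
  rewrite [a *m p2 *m p2]proj_mx_id ?proj_mx_sub//.
  rewrite (mulmxA a q q0) (mulmxA a q q1) add_proj_mx ?proj_mx_sub// add_proj_mx//.
  by apply: submx_full; exact: addsmx_compl_full.
- by rewrite mulmxA proj_mx_sub.
- by rewrite mulmxA (submx_trans (proj_mx_sub _ _ _))// diffmxSl.
- move=> aZ; have aH : (a <= H)%MS by rewrite (submx_trans aZ) ?addsmxSl.
  by rewrite p2_0// mulmxA qid// proj_mx_0.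
- by move=> aW; rewrite p2_0// (submx_trans aW).
Qed.

Lemma range_mx (E : lmodType F) (V : set E) m (g : 'I_m -> E -> F) :
  subsp V -> (forall j, islin (g j)) ->
  exists A : 'M[F]_m, forall r : 'rV_m,
    (exists2 v, V v & r = \row_j g j v) <-> (r <= A)%MS.
Proof.
move=> [V0 Vlin] glin; apply: subsp_mx; split.
  exists 0 => //; apply/rowP => j; rewrite !mxE.
  have := glin j (-1) 0 0; rewrite scaler0 addr0 mulN1r => {1}->.
  by rewrite addNr.
move=> a _ _ [v Vv ->] [w Vw ->]; exists (a *: v + w); first exact: Vlin.
by apply/rowP => j; rewrite !mxE glin.
Qed.

(** On [V] the values [g j v] determine [h v]. The coefficients come from the values of [h] at
    preimages of the rows of the range matrix, transported by its pseudoinverse. *)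
Lemma comb_of_ker_ord (E : lmodType F) (V : set E) m (g : 'I_m -> E -> F)
    (h : E -> F) :
  subsp V -> (forall j, islin (g j)) -> islin h ->
  (forall v, V v -> (forall j, g j v = 0) -> h v = 0) ->
  exists c : 'I_m -> F, forall v, V v -> h v = \sum_j c j * g j v.
Proof.
move=> sV glin hlin hker; have [A AP] := range_mx sV glin.
have /choice[v vP] (i : 'I_m) : exists v, V v /\ row i A = \row_j g j v.
  by have [v Vv rv] := (AP (row i A)).2 (row_sub i A); exists v.
pose c := pinvmx A *m \col_i h (v i).
exists (fun j => c j 0) => x Vx.
pose r := \row_j g j x; pose a := r *m pinvmx A.
have rA : (r <= A)%MS by apply/AP; exists x.
have aA : a *m A = r by exact: mulmxKpV.
have Vs : V (\sum_i a 0 i *: v i) by apply: subsp_sum => // i; have [] := vP i.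
have : h ((-1) *: (\sum_i a 0 i *: v i) + x) = 0.
  apply: hker; first exact: sV.2.
  move=> j; rewrite glin mulN1r islin_sum//.
  have -> : \sum_i a 0 i * g j (v i) = g j x; last by rewrite addNr.
  transitivity ((a *m A) 0 j); last by rewrite aA mxE.
  rewrite mxE; apply: eq_bigr => i _; congr (_ * _).
  by have [_ /rowP/(_ j)] := vP i; rewrite !mxE.
rewrite hlin mulN1r islin_sum// addrC => /eqP; rewrite subr_eq0 => /eqP->.
transitivity ((r *m c) 0 0).
  rewrite mulmxA -/a mxE; apply: eq_bigr => i _.
  by rewrite [in RHS](mxE _ (fun i _ => h (v i))).
by rewrite mxE; apply: eq_bigr => j _; rewrite [r 0 j]mxE mulrC.
Qed.

(** The columns of the cokernel of the range matrix are linear relations among the [g j] on [V]; a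
    vector [s] obeying all of them lies in the range. *)
Lemma interpolation_ord (E : lmodType F) (V : set E) m (g : 'I_m -> E -> F)
    (s : 'I_m -> F) :
  subsp V -> (forall j, islin (g j)) ->
  (forall c : 'I_m -> F, (forall v, V v -> \sum_j c j * g j v = 0) ->
    \sum_j c j * s j = 0) ->
  exists2 v, V v & forall j, g j v = s j.
Proof.
move=> sV glin hs; have [A AP] := range_mx sV glin.
have : (\row_j s j <= A)%MS.
  rewrite submxE; apply/eqP/rowP => k; rewrite mxE [RHS]mxE.
  transitivity (\sum_j cokermx A j k * s j).
    by apply: eq_bigr => j _; rewrite (mxE _ (fun _ j => s j)) mulrC.
  apply: hs => v Vv.
  have : (\row_j g j v <= A)%MS by apply/AP; exists v.
  rewrite submxE => /eqP/rowP/(_ k); rewrite mxE [RHS]mxE => h.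
  rewrite -[RHS]h; apply: eq_bigr => j _.
  by rewrite [in RHS](mxE _ (fun _ j => g j v)) mulrC.
by move=> /AP[v Vv /rowP sv]; exists v => // j; have := sv j; rewrite !mxE.
Qed.

Lemma comb_of_ker (E : lmodType F) (V : set E) (J : finType)
    (g : J -> E -> F) (h : E -> F) :
  subsp V -> (forall j, islin (g j)) -> islin h ->
  (forall v, V v -> (forall j, g j v = 0) -> h v = 0) ->
  exists c : J -> F, forall v, V v -> h v = \sum_j c j * g j v.
Proof.
move=> sV glin hlin hker.
have [v Vv gv|c cP] :=
    @comb_of_ker_ord E V #|J| (g \o enum_val) h sV (fun j => glin _) hlin.
  by apply: hker => // j; rewrite -[j]enum_rankK; exact: gv.
exists (c \o enum_rank) => v /cP->; rewrite [RHS]big_enum_val/=.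
by apply: eq_bigr => i _; rewrite enum_valK.
Qed.

Lemma interpolation (E : lmodType F) (V : set E) (J : finType)
    (g : J -> E -> F) (s : J -> F) :
  subsp V -> (forall j, islin (g j)) ->
  (forall c : J -> F, (forall v, V v -> \sum_j c j * g j v = 0) ->
    \sum_j c j * s j = 0) ->
  exists2 v, V v & forall j, g j v = s j.
Proof.
move=> sV glin hs.
have [c cV|v Vv gv] := @interpolation_ord E V #|J| (g \o enum_val)
    (s \o enum_val) sV (fun j => glin _).
  transitivity (\sum_j (c \o enum_rank) j * s j).
    by rewrite [RHS]big_enum_val/=; apply: eq_bigr => i _; rewrite enum_valK.
  apply: hs => v Vv; rewrite -[RHS](cV v Vv) [LHS]big_enum_val/=.
  by apply: eq_bigr => i _; rewrite enum_valK.
by exists v => // j; rewrite -[j]enum_rankK; exact: gv.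
Qed.

(** A biorthogonal system of maximal size is taken. A nonzero residual of some [h] in [L], paired
    with a corrected point, would enlarge it. *)
Lemma biorthogonal_basis (E : lmodType F) (L : set (E -> F)) m
    (e : 'I_m -> E -> F) :
  L (fun=> 0) ->
  (forall a f h, L f -> L h -> L (fun x => a * f x + h x)) ->
  (forall f, L f -> islin f) ->
  (forall f, L f -> exists c : 'I_m -> F, f = fun x => \sum_i c i * e i x) ->
  exists n (f : 'I_n -> E -> F) (p : 'I_n -> E),
  [/\ forall i, L (f i), forall i j, f i (p j) = (i == j)%:R &
      forall h, L h -> forall x, h x = \sum_i h (p i) * f i x].
Proof.
move=> L0 Llin Lislin Lspan.
(* The families are indexed by [nat] and constrained only below [n], so that enlarging a system is a
   mere test on the index. *)
pose Q n := `[< exists (f : nat -> E -> F) (p : nat -> E),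
  (forall i, (i < n)%N -> L (f i)) /\
  forall i j, (i < n)%N -> (j < n)%N -> f i (p j) = (i == j)%:R >].
have exQ : exists n, Q n by exists 0%N; apply/asboolP; exists (fun _ _ => 0), (fun=> 0).
(* Biorthogonality factors the identity matrix of size [n] through dimension [m]. *)
have Qm n : Q n -> (n <= m)%N.
  move=> /asboolP[f [p [Lf fp]]].
  have /choice[c cP] (i : 'I_n) :
      exists c : 'I_m -> F, f i = fun x => \sum_i c i * e i x.
    exact/Lspan/Lf.
  have : (1%:M : 'M[F]_n) =
      (\matrix_(i, j) c i j) *m (\matrix_(j < m, k < n) e j (p k)).
    apply/matrixP => i k; rewrite !mxE -(inj_eq val_inj)/= -fp// cP.
    by apply: eq_bigr => j _; rewrite !mxE.
  move=> /(congr1 (@mxrank _ _ _)); rewrite mxrank1 => ->.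
  by rewrite (leq_trans (mxrankM_maxl _ _))// rank_leq_col.
case: (ex_maxnP exQ Qm) => n /asboolP[f [p [Lf fp]]] nmax.
exists n, (fun i => f i), (fun i => p i); split=> [i|i j|h Lh x].
- exact: Lf.
- by rewrite fp.
apply: contrapT => hx.
have flin (i : 'I_n) : islin (f i) by exact/Lislin/Lf.
have Lsum (k : nat) (c : nat -> F) : (k <= n)%N ->
    L (fun x => h x - \sum_(i < k) c i * f i x).
  elim: k => [|k IH] kn; first by under eq_fun do rewrite big_ord0 subr0.
  have := Llin (- c k) _ _ (Lf k kn) (IH (ltnW kn)); congr (L _).
  by apply: funext => y; rewrite big_ord_recr/=; ring.
pose r x := h x - \sum_(i < n) h (p i) * f i x.
have Lr : L r by exact: (Lsum n (fun i => h (p i))).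
have rlin := Lislin _ Lr.
have rp j : (j < n)%N -> r (p j) = 0.
  move=> jn; rewrite /r (bigD1 (Ordinal jn))//= fp// eqxx mulr1 big1.
    by rewrite addr0 subrr.
  by move=> i /eqP ij; rewrite fp//; case: eqP => [e0|_];
    [case: ij; exact: val_inj|rewrite mulr0].
have rx : r x != 0 by rewrite subr_eq0; apply/eqP.
(* The correction makes every [f j] vanish at [x'] and keeps the value of [r], which vanishes at all
   [p i]. *)
pose x' := (-1) *: (\sum_(i < n) f i x *: p i) + x.
have fx' j : (j < n)%N -> f j x' = 0.
  move=> jn; have fl := flin (Ordinal jn); rewrite /= in fl.
  rewrite /x' fl islin_sum// (bigD1 (Ordinal jn))//= fp// eqxx mulr1 big1.
    by rewrite addr0 mulN1r addNr.
  by move=> i /eqP ij; rewrite fp//; case: eqP => [e0|_];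
    [case: ij; exact: val_inj|rewrite mulr0].
have rx' : r x' = r x.
  rewrite /x' rlin islin_sum// big1 ?mulr0 ?add0r// => i _.
  by rewrite rp// mulr0.
have linZ (u : E -> F) a y : islin u -> u (a *: y) = a * u y.
  move=> ul; have := @islin_sum E u 'I_1 (fun=> a) (fun=> y) ul.
  by rewrite !big_ord1.
have /nmax : Q n.+1; last by rewrite ltnn.
apply/asboolP; exists (fun i => if (i < n)%N then f i else r),
  (fun i => if (i < n)%N then p i else (r x)^-1 *: x'); split=> [i _|i j].
  by case: ifP => // /Lf.
rewrite !ltnS => iN jN.
case: ltnP => ni; case: ltnP => nj.
- exact: fp.
- rewrite linZ ?fx' ?mulr0//; last exact/Lislin/Lf.
  by rewrite ltn_eqF// (leq_trans ni).
- by rewrite rp// gtn_eqF// (leq_trans nj).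
- have -> : i = n by apply/eqP; rewrite eqn_leq iN.
  have -> : j = n by apply/eqP; rewrite eqn_leq jN.
  by rewrite linZ// rx' mulVf// eqxx.
Qed.

End LinearAlgebra.

(** * Linear functionals on the dual *)

Section Dual.
Variable K : numFieldType.

Definition dual_lin (Y : normedModType K) (s : (Y -> K^o) -> K) :=
  forall a g h, dual Y g -> dual Y h ->
    s (fun y => a * g y + h y) = a * s g + s h.

Lemma dual_islin (Y : normedModType K) (g : Y -> K^o) : dual Y g -> islin g.
Proof. by move=> [glin _] a x y; exact: glin. Qed.

Lemma dual0 (Y : normedModType K) : dual Y (fun=> 0).
Proof.
split=> [a x y|]; first by rewrite scaler0 addr0.
by exists 0 => x; rewrite normr0 mul0r.
Qed.

Lemma dual_comb (Y : normedModType K) (a : K) (g h : Y -> K^o) :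
  dual Y g -> dual Y h -> dual Y (fun y => a * g y + h y).
Proof.
move=> dg dh; have glin := dual_islin dg; have hlin := dual_islin dh.
split=> [b x y|].
  by rewrite glin hlin -[_ *: (a * g x + h x)]/(b * (a * g x + h x)); ring.
have [[_ [M gM]] [_ [N hN]]] := (dg, dh).
exists (`|a| * M + N) => x; rewrite (le_trans (ler_normD _ _))// mulrDl.
by rewrite normrM lerD// -mulrA ler_wpM2l.
Qed.

Lemma dual_sum (Y : normedModType K) (J : finType) (c : J -> K)
    (g : J -> Y -> K^o) :
  (forall j, dual Y (g j)) -> dual Y (fun y => \sum_j c j * g j y).
Proof.
move=> dg; suff h (r : seq J) : dual Y (fun y => \sum_(j <- r) c j * g j y).
  exact: h.
elim: r => [|j r IH].
  by have := dual0 Y; congr (dual Y _); apply: funext => y; rewrite big_nil.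
have := dual_comb (c j) (dg j) IH.
by congr (dual Y _); apply: funext => y; rewrite big_cons.
Qed.

Lemma dual_lin_sum (Y : normedModType K) (s : (Y -> K^o) -> K) (J : finType)
    (c : J -> K) (g : J -> Y -> K^o) :
  dual_lin s -> (forall j, dual Y (g j)) ->
  s (fun y => \sum_j c j * g j y) = \sum_j c j * s (g j).
Proof.
move=> slin dg.
have s0 : s (fun=> 0) = 0.
  have := slin (-1) _ _ (dual0 Y) (dual0 Y); rewrite [in RHS]mulN1r [RHS]addNr => h.
  rewrite -[RHS]h; congr s; apply: funext => y.
  by rewrite mulr0 addr0.
suff h (r : seq J) : dual Y (fun y => \sum_(j <- r) c j * g j y) /\
    s (fun y => \sum_(j <- r) c j * g j y) = \sum_(j <- r) c j * s (g j).
  by have [] := h (index_enum J).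
elim: r => [|j r [IH1 IH2]].
  rewrite big_nil -[RHS]s0.
  have -> : (fun y => \sum_(j <- [::]) c j * g j y) = (fun=> 0 : K^o).
    by apply: funext => y; rewrite big_nil.
  by split=> //; exact: dual0.
have -> : (fun y => \sum_(i <- j :: r) c i * g i y) =
    (fun y => c j * g j y + \sum_(i <- r) c i * g i y).
  by apply: funext => y; rewrite big_cons.
by split; [exact: dual_comb|rewrite slin// IH2 big_cons].
Qed.

(* [s] plays the role of an element of the weak-star closure of [V] in the
   bidual. *)
Lemma bidual_interpolation (Y : normedModType K) (J : finType)
    (g : J -> Y -> K^o) (V : set Y) (s : (Y -> K^o) -> K) :
  (forall j, dual Y (g j)) -> subsp V -> dual_lin s ->
  (forall h, perp V h -> s h = 0) ->
  exists t, [/\ V t, forall j, g j t = s (g j) &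
    forall h, dual Y h ->
      (forall v, V v -> (forall j, g j v = 0) -> h v = 0) -> s h = h t].
Proof.
move=> dg sV slin sV0.
have glin j : islin (g j) by exact: dual_islin.
(* A combination of the [g j] that vanishes on [V] is in [perp V], where [s] is zero; hence the
   prescribed values are compatible. *)
have [c cV|t Vt gt] := @interpolation _ _ V J g (s \o g) sV glin.
  by rewrite -dual_lin_sum//; apply: sV0; split=> //; exact: dual_sum.
exists t; split=> // h dh hker.
have [c cP] := comb_of_ker sV glin (dual_islin dh) hker.
have dc := dual_sum c dg.
have : s (fun y => -1 * (\sum_j c j * g j y) + h y) = 0.
  apply: sV0; split; first exact: dual_comb.
  by move=> v Vv; rewrite cP// mulN1r addNr.
rewrite slin// dual_lin_sum// mulN1r addrC => /eqP; rewrite subr_eq0 => /eqP->.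
by rewrite cP//; apply: eq_bigr => j _; rewrite gt.
Qed.

End Dual.

(** * Local reflexivity with a subspace constraint *)

Section LocalReflexivity.
Variables (R : realType) (K : numFieldType) (rp : real_part R K).

Lemma dual_separates (Y : normedModType K) (y z : Y) :
  (forall g, dual Y g -> g y = g z) -> y = z.
Proof.
move=> yz; apply/eqP; rewrite -subr_eq0; apply/negPn/negP => yz0.
have [||||g [[dg _]]] := @separation _ _ rp Y [set 0] (y - z) `|y - z|.
- by [].
- by move=> a u v -> ->; rewrite scaler0 addr0.
- by rewrite normr_gt0.
- by move=> v ->; rewrite subr0.
have := dual_islin dg (-1) z y.
rewrite scaleN1r mulN1r [- z + y]addrC [- g z + _]addrC yz// subrr => -> /eqP.
by rewrite eq_sym oner_eq0.
Qed.

(** A particular solution [t] of the linear equations comes from [bidual_interpolation]; Helly's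
    theorem then moves it by homogeneous solutions until all the combinations indexed by [I] are
    small at once. *)
Lemma helly_affine (Y : normedModType K) (J Q I : finType)
    (g : J -> Y -> K^o) (V : Q -> set Y) (s : Q -> (Y -> K^o) -> K)
    (y : I -> Y) (b : I -> Q -> K) (M c : K) :
  (forall j, dual Y (g j)) -> (forall q, subsp (V q)) ->
  (forall q, dual_lin (s q)) -> (forall q h, perp (V q) h -> s q h = 0) ->
  0 <= M -> M < c ->
  (forall k h, dual Y h -> forall N, 0 <= N -> bdd_by h N ->
    `|h (y k) + \sum_q b k q * s q h| <= M * N) ->
  exists u : Q -> Y, [/\ forall q, V q (u q),
    forall q j, g j (u q) = s q (g j) &
    forall k, `|y k + \sum_q b k q *: u q| <= c].
Proof.
move=> dg sV slin sV0 M0 Mc sM.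
have glin j : islin (g j) by exact: dual_islin.
have linD (f : Y -> K^o) v w : dual Y f -> f (v + w) = f v + f w.
  by move=> df; rewrite -[v]scale1r (dual_islin df) scale1r mul1r.
have lin0 (f : Y -> K^o) : dual Y f -> f 0 = 0.
  by move=> df; apply: (addIr (f 0)); rewrite -linD// !add0r.
have /choice[t tP] q :=
  bidual_interpolation dg (sV q) (slin q) (sV0 q).
pose ker q := [set w | V q w /\ forall j, g j w = 0].
have sker q : subsp (ker q).
  have [V0 Vlin] := sV q; split; first by split=> // j; exact: lin0.
  move=> a v w [Vv gv] [Vw gw]; split; first exact: Vlin.
  by move=> j; rewrite glin gv gw mulr0 addr0.
pose A := [set v : {ffun I -> Y} | exists w : Q -> Y, (forall q, ker q (w q)) /\
  v = [ffun k => \sum_q b k q *: w q]].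
have [|||v [w [kw ->]] vc] := @helly _ _ rp Y I
    [ffun k => y k + \sum_q b k q *: t q] A
    (fun k h => h (y k) + \sum_q b k q * s q h) M c _ _ M0 Mc sM.
- exists (fun=> 0); split; first by move=> q; have [] := sker q.
  by apply/ffunP => k; rewrite !ffunE big1// => q _; rewrite scaler0.
- move=> a _ _ [v [kv ->]] [w [kw ->]]; exists (fun q => a *: v q + w q).
  split; first by move=> q; apply: (sker q).2.
  apply/ffunP => k; rewrite !ffunE scaler_sumr -big_split/=.
  by apply: eq_bigr => q _; rewrite scalerDr !scalerA mulrC.
- move=> f df fA.
  pose h q : Y -> K^o := fun x => \sum_k b k q * f k x.
  have dh q : dual Y (h q) by exact: dual_sum.
  (* Testing [f] on families supported at the single index [q] shows that [h q] vanishes on [ker q],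
     as the last clause of [bidual_interpolation] requires. *)
  have hs q : s q (h q) = h q (t q).
    have [_ _] := tP q; apply=> // v Vv gv.
    have /fA : A [ffun k => \sum_r b k r *: (if r == q then v else 0)].
      exists (fun r => if r == q then v else 0); split=> // r.
      by case: eqP => [->//|_]; have [] := sker r.
    move=> fv; rewrite -[RHS]fv /h; apply: eq_bigr => k _; rewrite ffunE.
    rewrite (islin_sum _ _ (dual_islin (df k))) (bigD1 q)//= eqxx big1 ?addr0//.
    by move=> r /negbTE ->; rewrite lin0 ?mulr0.
  under [RHS]eq_bigr do rewrite ffunE linD//.
  rewrite !big_split/=; congr (_ + _).
  under [RHS]eq_bigr do rewrite (islin_sum _ _ (dual_islin (df _))).
  rewrite exchange_big/= [RHS]exchange_big/=; apply: eq_bigr => q _.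
  by rewrite -dual_lin_sum//; exact: hs.
exists (fun q => t q + w q); split.
- move=> q; have [Vt _ _] := tP q; have [Vw _] := kw q.
  by rewrite -[t q]scale1r; apply: (sV q).2.
- move=> q j; have [_ gt _] := tP q; have [_ gw] := kw q.
  by rewrite linD// gt gw addr0.
- move=> k; have := vc k; rewrite !ffunE -addrA -big_split/=.
  by under eq_bigr do rewrite -scalerDr.
Qed.

(** Splitting the coefficient vectors by [adapted_projections] makes the requirements independent:
    on the first part the values are forced points of [Y], on the second the unknowns are sought in
    [V], on the third only the [g j] restrict them. [helly_affine] then bounds the combinations
    given by the [z k]. *)
Lemma local_reflexivity (Y : normedModType K) (n : nat) (J I : finType)
    (phi : 'I_n -> (Y -> K^o) -> K) (g : J -> Y -> K^o) (V : set Y)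
    (W : set 'rV[K]_n) (z : I -> 'rV[K]_n) (M c : K) :
  (forall i, dual_lin (phi i)) -> (forall j, dual Y (g j)) ->
  closed_subspace V -> subsp W ->
  (forall a h, W a -> perp V h -> \sum_i a 0 i * phi i h = 0) ->
  0 <= M -> M < c ->
  (forall k h, dual Y h -> forall N, 0 <= N -> bdd_by h N ->
    `|\sum_i z k 0 i * phi i h| <= M * N) ->
  exists y : 'I_n -> Y, [/\
    forall a, W a -> V (\sum_i a 0 i *: y i),
    forall j i, g j (y i) = phi i (g j),
    forall (a : 'rV[K]_n) y0,
      (forall h, dual Y h -> \sum_i a 0 i * phi i h = h y0) ->
      \sum_i a 0 i *: y i = y0 &
    forall k, `|\sum_i z k 0 i *: y i| <= c].
Proof.
move=> philin dg cV sW WV M0 Mc zM.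
pose st (a : 'rV[K]_n) h := \sum_i a 0 i * phi i h.
have stlin h : islin (st^~ h).
  move=> a x y; rewrite /st mulr_sumr -big_split/=; apply: eq_bigr => i _.
  by rewrite !mxE; ring.
have stdlin a : dual_lin (st a).
  move=> b u v du dv; rewrite /st mulr_sumr -big_split/=; apply: eq_bigr => i _.
  by rewrite philin//; ring.
have linD (f : Y -> K^o) v w : dual Y f -> f (v + w) = f v + f w.
  by move=> df; rewrite -[v]scale1r (dual_islin df) scale1r mul1r.
have sV : subsp V by have [V0 [Vlin _]] := cV.
pose Z0 := [set a | exists y, forall h, dual Y h -> st a h = h y].
have sZ0 : subsp Z0.
  split.
    exists 0 => h dh; rewrite /st big1; last by move=> i _; rewrite mxE mul0r.
    by apply: (addIr (h 0)); rewrite -linD// !add0r.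
  move=> a u v [yu hu] [yv hv]; exists (a *: yu + yv) => h dh.
  by rewrite stlin hu// hv// (dual_islin dh).
have [Zm ZmP] := subsp_mx sZ0; have [Wm WmP] := subsp_mx sW.
have [p0 [p1 [p2 [pE pZ pW p0Z p2W]]]] := adapted_projections Zm Wm.
pose e i : 'rV[K]_n := delta_mx 0 i.
have rvE (a : 'rV[K]_n) : a = \sum_i a 0 i *: e i by exact: row_sum_delta.
have stM a (p : 'M[K]_n) h : st (a *m p) h = \sum_i a 0 i * st (e i *m p) h.
  rewrite {1}[a]rvE mulmx_suml; under eq_bigr do rewrite -scalemxAl.
  exact: (islin_sum _ _ (stlin h)).
have /choice[y0 y0P] i : Z0 (e i *m p0) by apply/ZmP.
pose Y0 (a : 'rV[K]_n) := \sum_i a 0 i *: y0 i.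
have Y0P a h : dual Y h -> h (Y0 a) = st (a *m p0) h.
  move=> dh; rewrite (islin_sum _ _ (dual_islin dh)) stM.
  by apply: eq_bigr => i _; rewrite y0P.
(* The left copy indexes the unknowns sought in [V], the right copy those allowed anywhere in
   [Y]. *)
pose Q : finType := ('I_n + 'I_n)%type.
pose s (q : Q) := st (match q with inl i => e i *m p1 | inr i => e i *m p2 end).
pose b (a : 'rV[K]_n) (q : Q) :=
  match q with inl i => (a *m p1) 0 i | inr i => (a *m p2) 0 i end.
have stE a h : dual Y h -> st a h = h (Y0 a) + \sum_q b a q * s q h.
  move=> dh; rewrite {1}[a]pE big_sumType/= -!stM Y0P//.
  have stD u v : st (u + v) h = st u h + st v h.
    by rewrite -[u]scale1r stlin scale1r mul1r.
  by rewrite !stD addrA.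
pose Vq (q : Q) := match q with inl _ => V | inr _ => setT end.
have sVq q : subsp (Vq q) by case: q.
have sVq0 q h : perp (Vq q) h -> s q h = 0.
  case: q => i /= hV; first by apply: WV => //; apply/WmP.
  (* Linearity over an empty sum gives the value zero at the zero functional, the only one
     annihilating the whole space. *)
  have := @dual_lin_sum K Y _ 'I_0 (fun=> 0) (fun=> h) (stdlin (e i *m p2))
    (fun=> hV.1).
  rewrite [RHS]big_ord0 => h0; rewrite -[RHS]h0; congr (st _ _).
  by apply: funext => x; rewrite big_ord0 hV.2.
have [|u [Vu gu uc]] := @helly_affine Y J Q I g Vq s (fun k => Y0 (z k))
    (fun k => b (z k)) M c dg sVq (fun q => stdlin _) sVq0 M0 Mc.
  by move=> k h dh N N0 hN; rewrite -stE//; exact: zM.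
pose y i := y0 i + \sum_q b (e i) q *: u q.
have yE (a : 'rV[K]_n) : \sum_i a 0 i *: y i = Y0 a + \sum_q b a q *: u q.
  under eq_bigr do rewrite scalerDr scaler_sumr.
  rewrite big_split/= exchange_big/=; congr (_ + _); apply: eq_bigr => q _.
  under eq_bigr do rewrite scalerA.
  rewrite -scaler_suml; congr (_ *: _).
  have bM (p : 'M[K]_n) i : \sum_k a 0 k * (e k *m p) 0 i = (a *m p) 0 i.
    by rewrite mxE; apply: eq_bigr => k _; rewrite -rowE mxE.
  by case: q => i /=; exact: bM.
exists y; split.
- move=> a Wa; rewrite yE.
  have aW : (a <= Wm)%MS by apply/WmP.
  (* Otherwise some [h] in [perp V] has value one at [Y0 a], although [st a h] and all the other
     terms of [stE] vanish. *)
  have VY0 : V (Y0 a).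
    apply: contrapT => /(perp_separates rp cV)[h [hV h1]].
    have := stE a h hV.1; rewrite h1 /st WV// big_sumType/=.
    rewrite big1 => [|i _]; last by rewrite (sVq0 (inl i)) ?mulr0.
    rewrite big1 => [|i _]; last by rewrite p2W// mxE mul0r.
    by rewrite !addr0 => /eqP; rewrite eq_sym oner_eq0.
  rewrite -[Y0 a]scale1r; apply: sV.2 => //.
  rewrite big_sumType/= [X in _ + X]big1 ?addr0; last first.
    by move=> i _; rewrite p2W// mxE scale0r.
  by apply: subsp_sum => // i; exact: (Vu (inl i)).
- move=> j i; have dgj := dg j.
  have -> : phi i (g j) = st (e i) (g j).
    rewrite /st (bigD1 i)//= !mxE !eqxx mul1r big1 ?addr0// => k ki.
    by rewrite mxE (negbTE ki) mul0r.
  rewrite stE// linD//; congr (_ + _).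
    rewrite /Y0 (bigD1 i)//= !mxE !eqxx scale1r big1 ?addr0// => k ki.
    by rewrite mxE (negbTE ki) scale0r.
  rewrite (islin_sum _ _ (dual_islin dgj)).
  by apply: eq_bigr => q _; rewrite gu.
- move=> a x ax; rewrite yE; apply: (dual_separates) => h dh.
  have aZ : (a <= Zm)%MS by apply/ZmP; exists x.
  have [a1 a2] := p0Z _ aZ.
  have b0 q : b a q = 0 by case: q => i /=; rewrite ?a1 ?a2 mxE.
  rewrite big1 ?addr0 => [|q _]; last by rewrite b0 scale0r.
  rewrite -ax// -/(st a h) stE// big1 ?addr0// => q _.
  by rewrite b0 mul0r.
- by move=> k; rewrite yE.
Qed.

End LocalReflexivity.

(** * Finite-rank operators on the dual and the construction of [T] *)

Section FiniteRank.
Variables (R : realType) (K : numFieldType) (rp : real_part R K).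

(** The ball is approximated only as seen by the [f i]. A finite scalar net cuts their bounded
    values into cells, and each cell that is met contributes one point of the ball. The net has mesh
    [d / 2] because two points of a cell are compared through its centre. *)
Lemma unit_ball_net (X : normedModType K) n (f : 'I_n -> X -> K^o) (d : K) :
  (forall i, dual X (f i)) -> 0 < d ->
  exists (I : finType) (z : I -> X), (forall k, `|z k| <= 1) /\
    forall x, `|x| <= 1 -> exists k, forall i, `|f i x - f i (z k)| <= d.
Proof.
move=> df d0.
have /choice[M fM] i : exists M, bdd_by (f i) M by have [_] := df i.
have fB i x : `|x| <= 1 -> `|f i x| <= \sum_i `|M i|.
  move=> x1; have Mx := fM i x.
  rewrite (le_trans Mx)//.
  have -> : M i * `|x| = `|M i| * `|x|.
    by rewrite -[LHS]ger0_norm ?normrM ?normr_id// (le_trans _ Mx).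
  rewrite (bigD1 i)//= (le_trans (ler_piMr _ x1))//.
  by rewrite lerDl sumr_ge0.
have d20 : 0 < d / 2 by rewrite divr_gt0.
have [s sP] := scalar_net rp (\sum_i `|M i|) d20.
pose I : finType := {ffun 'I_n -> 'I_(size s)}.
pose near (k : I) x := `|x| <= 1 /\ forall i, `|f i x - s`_(k i)| <= d / 2.
have /choice[z zP] (k : I) :
    exists z, `|z| <= 1 /\ ((exists x, near k x) -> near k z).
  have [[x kx]|nk] := pselect (exists x, near k x).
    by exists x; split=> //; case: kx.
  by exists 0; rewrite normr0 ler01.
exists I, z; split=> [k|x x1]; first by have [] := zP k.
have /choice[k kP] i : exists k : 'I_(size s), `|f i x - s`_k| <= d / 2.
  have [w /(nthP 0)[k ks <-] wd] := sP _ (fB i x x1).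
  by exists (Ordinal ks).
pose k' : I := [ffun i => k i].
have [|_ zk] := (zP k').2.
  by exists x; split=> // i; rewrite ffunE.
exists k' => i; rewrite (splitr d) -(subrKA (s`_(k' i))).
rewrite (le_trans (ler_normD _ _))// lerD//; last by rewrite distrC.
by rewrite ffunE.
Qed.

Lemma dual_fin_op_lin (X Y : normedModType K)
    (S : (Y -> K^o) -> (X -> K^o)) (x : X) :
  dual_fin_op S -> dual_lin (fun g => S g x).
Proof. by move=> [_ [Slin _]] a g h dg dh; rewrite Slin. Qed.

Lemma dual_fin_op_basis (X Y : normedModType K)
    (S : (Y -> K^o) -> (X -> K^o)) : dual_fin_op S ->
  exists n (g : 'I_n -> Y -> K^o) (p : 'I_n -> X),
  [/\ forall i, dual Y (g i), forall i j, S (g i) (p j) = (i == j)%:R &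
      forall h, dual Y h -> forall x, S h x = \sum_i S h (p i) * S (g i) x].
Proof.
move=> SF; have [Sd [Slin [_ [m [e Se]]]]] := SF.
have [||||n [f [p [Lf fp hE]]]] :=
    @biorthogonal_basis K X (S @` dual Y) m e.
- exists (fun=> 0); first exact: dual0.
  apply: funext => x.
  have := @dual_lin_sum K Y _ 'I_0 (fun=> 0) (fun=> fun=> 0)
    (dual_fin_op_lin x SF) (fun=> dual0 Y).
  rewrite [RHS]big_ord0 => h0; rewrite -[RHS]h0; congr (S _ _).
  by apply: funext => y; rewrite big_ord0.
- move=> a _ _ [g dg <-] [h dh <-]; exists (fun y => a * g y + h y).
    exact: dual_comb.
  exact: Slin.
- by move=> _ [g dg <-]; apply: dual_islin; exact: Sd.
- by move=> _ [g dg <-]; exact: Se.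
have /choice[g gP] i : exists g, dual Y g /\ S g = f i.
  by have [g dg gf] := Lf i; exists g.
exists n, g, p; split.
- by move=> i; have [] := gP i.
- by move=> i j; have [_ ->] := gP i.
- move=> h dh x; rewrite (hE (S h))//.
  by apply: eq_bigr => i _; have [_ ->] := gP i.
Qed.

Lemma dual_bdd_norm (X Y : normedModType K)
    (S : (Y -> K^o) -> (X -> K^o)) (M : K) :
  dual_bdd_by S M -> dual_bdd_by S `|M|.
Proof.
move=> SM g dg N N0 gN x; have h := SM g dg N N0 gN x.
rewrite (le_trans h)// -[leLHS]ger0_norm ?(le_trans _ h)//.
by rewrite !normrM normr_id (ger0_norm N0).
Qed.

(** The number [nS - eps / 2] is too small to bound [S], and a functional at which this bound fails
    serves; if the number is negative, the zero functional does. *)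
Lemma almost_norming_functional (X Y : normedModType K)
    (S : (Y -> K^o) -> (X -> K^o)) (nS eps : K) :
  dual_opnorm_is S nS -> 0 < eps ->
  exists2 g, dual Y g & forall nT, 0 <= nT ->
    (forall N, 0 <= N -> bdd_by g N -> bdd_by (S g) (nT * N)) ->
    nS - eps < nT.
Proof.
move=> [nS0 [SnS nSmin]] eps0; pose M := nS - eps / 2.
have e20 : 0 < eps / 2 by rewrite divr_gt0.
have Mr : M \is Num.real by rewrite rpredB ?ger0_real ?gtr0_real// ltW.
have MS : nS - eps < M by rewrite ltrD2l ltrN2 {2}(splitr eps) ltrDl.
have [M0|M0] := real_ltP Mr (real0 K).
  by exists (fun=> 0); [exact: dual0|move=> nT nT0 _; rewrite (lt_trans MS)// (lt_le_trans M0)].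
have nMS : ~ dual_bdd_by S M.
  move=> /(nSmin _ M0); rewrite lerDl oppr_ge0 => /(lt_le_trans e20).
  by rewrite ltxx.
apply: contrapT => noG; apply: nMS => g dg N N0 gN.
apply: contrapT => nb; apply: noG; exists g => // nT nT0 gT.
rewrite (lt_le_trans MS)// real_leNgt// ?ger0_real//; apply/negP => nTM.
apply: nb => x; apply: (le_trans (gT N N0 gN x)).
by rewrite ler_wpM2r// ler_wpM2r// ltW.
Qed.

Lemma finite_rank_dualization (X Y : normedModType K) (U : set X) (V : set Y)
    (S : (Y -> K^o) -> (X -> K^o)) (J : finType) (e : J -> Y -> K^o) (eps : K) :
  closed_subspace U -> closed_subspace V ->
  dual_fin_op S -> S @` perp V `<=` perp U ->
  (forall j, dual Y (e j)) -> 0 < eps ->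
  exists T : X -> Y,
    fin_op T /\ T @` U `<=` V /\
    (forall nT nS, opnorm_is T nT -> dual_opnorm_is S nS -> `|nT - nS| < eps) /\
    (forall j, adjoint T (e j) = S (e j)) /\
    adjoint T @` dual Y = S @` dual Y /\
    (forall x'', bidual X x'' -> in_canon (dadjoint S x'') ->
       bidual_eq (dadjoint (adjoint T) x'') (dadjoint S x'')).
Proof.
move=> cU cV SF SVU de eps0.
have [n [g [p [dg gp gE]]]] := dual_fin_op_basis SF.
have [Sd [Slin [[M0 SM0] _]]] := SF.
pose f i := S (g i).
have df i : dual X (f i) by exact: Sd.
have flin i : islin (f i) by exact: dual_islin.
(* [M] is the norm of [S] if [dual_opnorm_is] holds for some value, and some nonnegative bound
   otherwise, when the norm comparison is vacuous. *)
have [M [Mge0 SM Muniq]] : exists M : K, [/\ 0 <= M, dual_bdd_by S M &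
    forall nS, dual_opnorm_is S nS -> nS = M].
  have [[nS nSP]|no] := pselect (exists nS, dual_opnorm_is S nS); last first.
    exists `|M0|; split=> //; first exact: dual_bdd_norm.
    by move=> nS nSP; case: no; exists nS.
  exists nS; have [? [? nSmin]] := nSP; split=> // m [? [? mmin]].
  by apply/eqP; rewrite eq_le nSmin// mmin.
have [gl dgl glP] : exists2 gl, dual Y gl & forall nT, 0 <= nT ->
    (forall N, 0 <= N -> bdd_by gl N -> bdd_by (S gl) (nT * N)) ->
    forall nS, dual_opnorm_is S nS -> nS - eps < nT.
  have [[nS nSP]|no] := pselect (exists nS, dual_opnorm_is S nS); last first.
    exists (fun=> 0); first exact: dual0.
    by move=> nT _ _ nS nSP; case: no; exists nS.
  have [gl dgl glP] := almost_norming_functional nSP eps0.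
  exists gl => // nT nT0 h nS' nS'P.
  by rewrite (Muniq _ nS'P) -(Muniq _ nSP); exact: glP.
pose C := \sum_i `|p i|.
have C0 : 0 <= C by exact: sumr_ge0.
have Me : 0 < M + eps by rewrite ltr_wpDl.
(* Chosen so that [(M + eps) * (1 - eta) = M + eps / 2], which exceeds the bound [M + eps / 4]
   imposed on the net. *)
pose eta := eps / (2 * (M + eps)).
have eta0 : 0 < eta by rewrite divr_gt0// mulr_gt0.
have C10 : 0 < C + 1 by rewrite ltr_wpDl.
(* The added one covers [n = 0], where [C] is zero. *)
pose d := eta / (C + 1).
have d0 : 0 < d by rewrite divr_gt0.
have dC : d * C <= eta.
  by rewrite mulrAC ler_pdivrMr// ler_wpM2l ?ltW// ltrDl.
have [I [z [z1 zP]]] := unit_ball_net df d0.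
(* The functionals at which [T] must reproduce [S]: the given ones, the [g i] for the range, and
   [gl] for the lower norm bound. *)
pose G (q : J + ('I_n + unit)) : Y -> K^o :=
  match q with inl j => e j | inr (inl i) => g i | inr (inr _) => gl end.
have dG q : dual Y (G q) by case: q => [j|[i|[]]] /=.
pose W := [set a : 'rV[K]_n | exists2 x, U x & a = \row_i f i x].
have sW : subsp W.
  have [U0 [Ulin _]] := cU; split.
    exists 0 => //; apply/rowP => i; rewrite !mxE.
    have := flin i (-1) 0 0; rewrite scaler0 addr0 mulN1r => {1}->.
    by rewrite addNr.
  move=> a _ _ [x Ux ->] [y Uy ->]; exists (a *: x + y); first exact: Ulin.
  by apply/rowP => i; rewrite !mxE flin.
have rowS x h : dual Y h -> \sum_i (\row_i f i x) 0 i * S h (p i) = S h x.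
  by move=> dh; rewrite [RHS]gE//; apply: eq_bigr => i _; rewrite mxE mulrC.
pose c := M + eps / 4.
have Mc : M < c by rewrite ltrDl divr_gt0.
have [||y [yW yG yZ yz]] := @local_reflexivity _ _ rp Y n _ I
    (fun i h => S h (p i)) G V W (fun k => \row_i f i (z k)) M c
    (fun i => dual_fin_op_lin (p i) SF) dG cV sW _ Mge0 Mc.
- move=> _ h [x Ux ->] hV; rewrite rowS; last exact: hV.1.
  have /SVU[_ hU] : (S @` perp V) (S h) by exists h.
  exact: hU.
- move=> k h dh N N0 hN; rewrite rowS//.
  rewrite (le_trans (SM h dh N N0 hN _))//.
  by rewrite ler_piMr// mulr_ge0.
pose T x := \sum_i f i x *: y i.
have TE x : \sum_i (\row_i f i x) 0 i *: y i = T x.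
  by apply: eq_bigr => i _; rewrite mxE.
have Tlin : is_lin T.
  move=> a u v; rewrite /T scaler_sumr -big_split/=; apply: eq_bigr => i _.
  by rewrite flin scalerDl scalerA.
have gT h x : dual Y h -> h (T x) = \sum_i h (y i) * f i x.
  move=> dh; rewrite (islin_sum _ _ (dual_islin dh)).
  by apply: eq_bigr => i _; rewrite mulrC.
have TG q : adjoint T (G q) = S (G q).
  apply: funext => x; rewrite /adjoint/= gT// gE//.
  by apply: eq_bigr => i _; rewrite yG.
have Tdual h : dual Y h -> adjoint T h = fun x => \sum_i h (y i) * f i x.
  by move=> dh; apply: funext => x; exact: gT.
exists T; split; [|split; [|split; [|split; [|split]]]].
- split; last by exists n, y => x; exists (fun i => f i x).
  split=> //.
  have /choice[m fm] i : exists m, bdd_by (f i) m by have [_] := df i.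
  exists (\sum_i m i * `|y i|) => x; rewrite (le_trans (ler_norm_sum _ _ _))//.
  rewrite mulr_suml; apply: ler_sum => i _; rewrite normrZ mulrAC.
  by rewrite ler_wpM2r//; exact: fm.
- by move=> _ [x Ux <-]; rewrite -TE; apply: yW; exists x.
- move=> nT nS [nT0 [TnT nTmin]] nSP.
  have nS0 : 0 <= nS by case: nSP.
  rewrite real_ltr_distl ?rpredB ?ger0_real//; apply/andP; split.
    apply: (glP nT) => // N N0 glN x; rewrite -(TG (inr (inr tt))) /=.
    rewrite (le_trans (glN _))// [nT * N]mulrC -mulrA ler_wpM2l//.
  rewrite (Muniq _ nSP).
  rewrite real_ltNge ?ger0_real ?(ltW Me)//; apply/negP => MT.
  have Tball x : `|x| <= 1 -> `|T x| <= c + nT * eta.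
    move=> /zP[k kP].
    (* By biorthogonality [T x - T (z k)] is the image under [T] of a vector of norm at most [eta],
       so the net error is measured by [nT] itself, whatever the size of the [y i]. *)
    have -> : T x = T (z k) + T (\sum_i (f i x - f i (z k)) *: p i).
      have -> : T (\sum_i (f i x - f i (z k)) *: p i) = T x - T (z k).
        rewrite /T -sumrB; apply: eq_bigr => i _; rewrite -scalerBl.
        congr (_ *: _); rewrite islin_sum// (bigD1 i)//= /f gp eqxx mulr1.
        rewrite big1 ?addr0// => j ji; rewrite gp eq_sym.
        by rewrite (negbTE ji) mulr0.
      by rewrite addrC subrK.
    rewrite (le_trans (ler_normD _ _))// lerD//.
      by have := yz k; rewrite TE.
    rewrite (le_trans (TnT _))// ler_wpM2l// (le_trans _ dC)//.
    rewrite (le_trans (ler_norm_sum _ _ _))// mulr_sumr; apply: ler_sum => i _.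
    by rewrite normrZ ler_wpM2r.
  have : nT <= c + nT * eta.
    apply: nTmin.
      by apply: addr_ge0; [exact: le_trans (ltW Mc)|exact: mulr_ge0 (ltW eta0)].
    move=> x; have [->|x0] := eqVneq x 0.
      have := TnT 0; rewrite normr0 !mulr0.
      by [].
    have x0' : 0 < `|x| by rewrite normr_gt0.
    have -> : T x = `|x| *: T (`|x|^-1 *: x).
      rewrite /T scaler_sumr; apply: eq_bigr => i _.
      have -> : f i (`|x|^-1 *: x) = `|x|^-1 * f i x.
        have := @islin_sum K X (f i) 'I_1 (fun=> `|x|^-1) (fun=> x) (flin i).
        by rewrite !big_ord1.
      by rewrite scalerA mulrA divff ?gt_eqF// mul1r.
    rewrite normrZ normr_id mulrC ler_wpM2r// Tball//.
    by rewrite normrZ normfV normr_id mulVf ?gt_eqF.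
  rewrite -lerBlDr -{1}[nT]mulr1 -mulrBr => nTc.
  have eta1 : 0 <= 1 - eta.
    rewrite subr_ge0 ler_pdivrMr ?mulr_gt0// mul1r mulrDr.
    rewrite ler_wpDl ?mulr_ge0// ler_peMl ?(ltW eps0)//.
    by rewrite ler1n.
  (* If [nT] reached [M + eps], then [M + eps / 2 <= M + eps / 4] would follow. *)
  have := le_trans (ler_wpM2r eta1 MT) nTc.
  have -> : (M + eps) * (1 - eta) = M + eps / 2.
    by rewrite /eta; field; rewrite gt_eqF.
  rewrite lerD2l ler_pM2l// lef_pV2 ?posrE// ler_nat.
  by [].
- by move=> j; exact: (TG (inl j)).
(* Both ranges are spanned by the [S (g i)]: one inclusion expands [h \o T], the other uses
   agreement at the [g i]. *)
- apply/seteqP; split=> _ [h dh <-].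
    exists (fun x => \sum_i h (y i) * g i x); first exact: dual_sum.
    rewrite Tdual//; apply: funext => x.
    exact: (dual_lin_sum _ (dual_fin_op_lin x SF) dg).
  exists (fun x => \sum_i S h (p i) * g i x); first exact: dual_sum.
  apply: funext => x; rewrite [RHS]gE// /adjoint/=; apply: eq_bigr => i _.
  by rewrite -(TG (inr (inl i))).
- move=> x'' [xlin _] [y0 xy0] h dh; rewrite xy0// /dadjoint/= Tdual//.
  have xl : dual_lin x'' by exact: xlin.
  rewrite dual_lin_sum//.
  (* The coefficients [x'' (f i)] express [dadjoint S x''] through the functionals
     [h |-> S h (p i)]. As it is evaluation at [y0], the same combination of the [y i] equals
     [y0]. *)
  rewrite -(yZ (\row_i x'' (f i)) y0).
    rewrite (islin_sum _ _ (dual_islin dh)); apply: eq_bigr => i _.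
    by rewrite mxE mulrC.
  move=> k dk; rewrite -xy0// /dadjoint/=.
  have -> : S k = fun x => \sum_i S k (p i) * f i x.
    by apply: funext => x; exact: gE.
  rewrite dual_lin_sum//; apply: eq_bigr => i _; rewrite mxE mulrC.
  by congr (_ * _); rewrite -gE.
Qed.

Lemma adjoint_eq_comb (X Y : normedModType K) (S : (Y -> K^o) -> (X -> K^o))
    (T : X -> Y) n (e : 'I_n -> Y -> K^o) (c : 'I_n -> K) :
  dual_fin_op S -> (forall i, dual Y (e i)) ->
  (forall i, adjoint T (e i) = S (e i)) ->
  adjoint T (fun y => \sum_i c i * e i y) = S (fun y => \sum_i c i * e i y).
Proof.
move=> SF de Te; apply: funext => x.
rewrite (dual_lin_sum _ (dual_fin_op_lin x SF) de) /adjoint/=.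
by apply: eq_bigr => i _; rewrite -Te.
Qed.

(** Requiring agreement at the [S (g i)] too makes [adjoint T] coincide with [S] on the range of
    [S], where [S] is the identity. As [adjoint T] has this same range, it is idempotent, and so is
    [T] because functionals separate points. *)
Lemma finite_rank_projection (X : normedModType K) (U V : set X)
    (S : (X -> K^o) -> (X -> K^o)) (J : finType) (e : J -> X -> K^o) (eps : K) :
  closed_subspace U -> closed_subspace V ->
  dual_fin_op S -> S @` perp V `<=` perp U ->
  (forall g, dual X g -> S (S g) = S g) ->
  (forall j, dual X (e j)) -> 0 < eps ->
  exists T : X -> X,
    fin_op T /\ T @` U `<=` V /\
    (forall nT nS, opnorm_is T nT -> dual_opnorm_is S nS -> `|nT - nS| < eps) /\
    (forall j, adjoint T (e j) = S (e j)) /\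
    adjoint T @` dual X = S @` dual X /\
    (forall x'', bidual X x'' -> in_canon (dadjoint S x'') ->
       bidual_eq (dadjoint (adjoint T) x'') (dadjoint S x'')) /\
    (forall x, T (T x) = T x).
Proof.
move=> cU cV SF SVU SS de eps0.
have [n [g [p [dg gp gE]]]] := dual_fin_op_basis SF.
have Sd h : dual X h -> dual X (S h) by have [Sd _] := SF; exact: Sd.
pose G (q : J + 'I_n) : X -> K^o :=
  match q with inl j => e j | inr i => S (g i) end.
have dG q : dual X (G q) by case: q => [j|i] //=; exact: Sd.
have [T [TF [TU [Tn [TG [Tran Tbi]]]]]] :=
  finite_rank_dualization cU cV SF SVU dG eps0.
exists T; do 3!split=> //; split; first by move=> j; exact: (TG (inl j)).
do 2!split=> //.
move=> x; apply: (dual_separates rp) => h dh.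
have [k dk kh] : (S @` dual X) (adjoint T h) by rewrite -Tran; exists h.
have -> : h (T (T x)) = S k (T x) by rewrite kh.
have -> : h (T x) = S k x by rewrite kh.
have Sk : S k = fun x => \sum_i S k (p i) * S (g i) x.
  by apply: funext => w; exact: gE.
rewrite -[in RHS]SS// {1}Sk.
rewrite -[LHS]/(adjoint T (fun x => \sum_i S k (p i) * S (g i) x) x).
rewrite (adjoint_eq_comb (fun i => S k (p i)) SF (fun i => Sd _ (dg i))).
  by rewrite -Sk.
by move=> i; exact: (TG (inr i)).
Qed.

End FiniteRank.

(** * Both scalar fields at once, with [F] replaced by a spanning family *)

Theorem theorem1p3 (R : realType) (b : bool) :
  (forall (X Y : completeNormedModType (Kb R b)) (U : set X) (V : set Y)
     (S : (Y -> (Kb R b)^o) -> (X -> (Kb R b)^o)) (F : set (Y -> (Kb R b)^o))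
     (eps : Kb R b),
     closed_subspace U -> closed_subspace V ->
     dual_fin_op S -> S @` perp V `<=` perp U ->
     fd_dual_subspace F -> 0 < eps ->
     exists T : X -> Y,
       fin_op T /\ T @` U `<=` V /\
       (forall nT nS, opnorm_is T nT -> dual_opnorm_is S nS -> `|nT - nS| < eps) /\
       (forall g, F g -> adjoint T g = S g) /\
       adjoint T @` dual Y = S @` dual Y /\
       (forall x'', bidual X x'' -> in_canon (dadjoint S x'') ->
          bidual_eq (dadjoint (adjoint T) x'') (dadjoint S x''))) /\
  (forall (X : completeNormedModType (Kb R b)) (U V : set X)
     (S : (X -> (Kb R b)^o) -> (X -> (Kb R b)^o)) (F : set (X -> (Kb R b)^o))
     (eps : Kb R b),
     closed_subspace U -> closed_subspace V ->
     dual_fin_op S -> S @` perp V `<=` perp U ->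
     (forall g, dual X g -> S (S g) = S g) ->
     fd_dual_subspace F -> 0 < eps ->
     exists T : X -> X,
       fin_op T /\ T @` U `<=` V /\
       (forall nT nS, opnorm_is T nT -> dual_opnorm_is S nS -> `|nT - nS| < eps) /\
       (forall g, F g -> adjoint T g = S g) /\
       adjoint T @` dual X = S @` dual X /\
       (forall x'', bidual X x'' -> in_canon (dadjoint S x'') ->
          bidual_eq (dadjoint (adjoint T) x'') (dadjoint S x'')) /\
       (forall x, T (T x) = T x)).
Proof.
have rp : real_part R (Kb R b).
  by case: b; [exact: real_part_real|exact: real_part_complex].
split.
- move=> X Y U V S F eps cU cV SF SVU [n [e [de ->]]] eps0.
  have [T [TF [TU [Tn [Te Trest]]]]] :=
    finite_rank_dualization rp cU cV SF SVU de eps0.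
  exists T; do 3!split=> //; split=> // g [c ->].
  exact: adjoint_eq_comb.
- move=> X U V S F eps cU cV SF SVU SS [n [e [de ->]]] eps0.
  have [T [TF [TU [Tn [Te Trest]]]]] :=
    finite_rank_projection rp cU cV SF SVU SS de eps0.
  exists T; do 3!split=> //; split=> // g [c ->].
  exact: adjoint_eq_comb.
Qed.
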